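(* The class of submetrizable balleans is $\lambda$-stable.
   Context: A coarse structure on a set $X$ is a family $\mathcal{E}$ of subsets of $X\times X$ such that: each $E\in\mathcal{E}$ contains the diagonal $\triangle_X=\{(x,x):x\in X\}$; if $E,E'\in\mathcal{E}$ then $E\circ E'\in\mathcal{E}$ and $E^{-1}\in\mathcal{E}$, where $E\circ E'=\{(x,y):\exists z\,((x,z)\in E,\ (z,y)\in E')\}$ and $E^{-1}=\{(y,x):(x,y)\in E\}$; if $E\in\mathcal{E}$ and $\triangle_X\subseteq E'\subseteq E$ then $E'\in\mathcal{E}$; and $\bigcup\mathcal{E}=X\times X$. The pair $(X,\mathcal{E})$ is called a ballean (or coarse space). A subfamily $\mathcal{E}'\subseteq\mathcal{E}$ is a base for $\mathcal{E}$ if every $E\in\mathcal{E}$ is contained in some $E'\in\mathcal{E}'$. For $E\in\mathcal{E}$, $x\in X$, $A\subseteq X$: $E[x]=\{y\in X:(x,y)\in E\}$ and $E[A]=\bigcup_{a\in A}E[a]$. A subset $B\subseteq X$ is bounded if $B\subseteq E[x]$ for some $E\in\mathcal{E}$, $x\in X$; otherwise it is unbounded. A ballean is bounded (unbounded) if $X$ is. Subsets $A,B$ of $X$ are close if there is $E\in\mathcal{E}$ with $A\subseteq E[B]$ and $B\subseteq E[A]$. They are linked, written $A\,\lambda_{(X,\mathcal{E})}\,B$, if either both $A,B$ are bounded or there exist unbounded subsets $A'\subseteq A$, $B'\subseteq B$ that are close. Balleans $(X,\mathcal{E})$, $(X,\mathcal{E}')$ on the same set are $\lambda$-equivalent if $\lambda_{(X,\mathcal{E})}=\lambda_{(X,\mathcal{E}')}$.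 A class $\mathcal{K}$ of balleans is $\lambda$-stable if for any two $\lambda$-equivalent balleans $(X,\mathcal{E})$, $(X,\mathcal{E}')$, $(X,\mathcal{E})\in\mathcal{K}$ implies $(X,\mathcal{E}')\in\mathcal{K}$. A ballean $(X,\mathcal{E})$ is metrizable if there is a metric $d$ on $X$ such that $\{\{(x,y):d(x,y)<r\}:r\in\mathbb{R}^+\}$ is a base for $\mathcal{E}$. An unbounded ballean $(X,\mathcal{E})$ is submetrizable if there is a coarse structure $\mathcal{E}'$ on $X$ such that $\mathcal{E}\subseteq\mathcal{E}'$ and $(X,\mathcal{E}')$ is unbounded and metrizable. *)

(* Defs.v *)
From mathcomp Require Import all_boot all_order all_algebra.
From mathcomp Require Import boolp classical_sets reals.

Set Implicit Arguments.
Unset Strict Implicit.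
Unset Printing Implicit Defensive.

Import Order.TTheory GRing.Theory Num.Theory.
Local Open Scope classical_set_scope.
Local Open Scope ring_scope.

(* The library's relational composition [E' \; E] is
   {(x, y) | exists z, (x, z) \in E and (z, y) \in E'}, that is, E o E'. *)
Record coarse_structure (X : Type) := CoarseStructure {
  entourages : set (set (X * X));
  entourages_diagonal : forall E, entourages E -> diagonal `<=` E;
  entourages_compose : forall E E',
    entourages E -> entourages E' -> entourages (E' \; E)%relation;
  entourages_inv : forall E, entourages E -> entourages (E^-1)%relation;
  entourages_sub : forall E E',
    entourages E -> diagonal `<=` E' -> E' `<=` E -> entourages E';
  entourages_cover : \bigcup_(E in entourages) E = setT
}.

(* E[A]; the set E[x] is [xsection E x]. *)
Definition ent_image (X : Type) (E : set (X * X)) (A : set X) : set X :=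
  \bigcup_(a in A) xsection E a.

Definition is_base (X : Type) (B : set (set (X * X)))
    (C : coarse_structure X) : Prop :=
  B `<=` entourages C /\
  forall E, entourages C E -> exists2 E', B E' & E `<=` E'.

Definition bounded (X : Type) (C : coarse_structure X) (B : set X) : Prop :=
  exists E x, entourages C E /\ B `<=` xsection E x.

Definition unbounded (X : Type) (C : coarse_structure X) (B : set X) : Prop :=
  ~ bounded C B.

Definition unbounded_ballean (X : Type) (C : coarse_structure X) : Prop :=
  unbounded C [set: X].

Definition close (X : Type) (C : coarse_structure X) (A B : set X) : Prop :=
  exists E, [/\ entourages C E, A `<=` ent_image E B & B `<=` ent_image E A].

Definition linked (X : Type) (C : coarse_structure X) (A B : set X) : Prop :=
  (bounded C A /\ bounded C B) \/
  exists A' B', [/\ A' `<=` A, B' `<=` B, unbounded C A', unbounded C B' &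
                    close C A' B'].

Definition lambda_equivalent (X : Type) (C C' : coarse_structure X) : Prop :=
  linked C = linked C'.

(* A class of balleans (X, C) is a predicate over all sets X and all coarse
   structures C on X. *)
Definition lambda_stable (K : forall X : Type, coarse_structure X -> Prop) :
    Prop :=
  forall (X : Type) (C C' : coarse_structure X),
    lambda_equivalent C C' -> K X C -> K X C'.

(* The library's metricType bundles a choiceType carrier and a topology; here
   a bare distance function on an arbitrary type is needed. *)
Definition is_metric (R : realType) (X : Type) (d : X -> X -> R) : Prop :=
  [/\ forall x y, 0 <= d x y,
      forall x y, d x y = 0 <-> x = y,
      forall x y, d x y = d y x &
      forall x y z, d x z <= d x y + d y z].

Definition metrizable (R : realType) (X : Type) (C : coarse_structure X) :
    Prop :=
  exists d : X -> X -> R, is_metric d /\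
    is_base [set [set xy : X * X | d xy.1 xy.2 < r] | r in [set r : R | 0 < r]]
            C.

Definition submetrizable (R : realType) (X : Type) (C : coarse_structure X) :
    Prop :=
  unbounded_ballean C /\
  exists C' : coarse_structure X,
    [/\ entourages C `<=` entourages C', unbounded_ballean C' &
        metrizable R C'].

(* Main.v *)
Require Import Defs.
From mathcomp Require Import all_boot all_order all_algebra.
From mathcomp Require Import boolp classical_sets reals.
From mathcomp Require Import lra.

(** A ballean is submetrizable iff it carries a bornologous
    real function with unbounded range: take the distance to a
    point, and conversely pull back the metric of the line.  If such an [f] for
    [C] were not bornologous for a [lambda]-equivalent [C'], some entourage of
    [C'] would contain pairs [(x n, y n)] such that [f (x n)] and [f (y m)] are
    far apart whenever [m] is large, for every [n].  The sets of all [x n] and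
    of all [y m] are linked in [C'], hence in [C]; but [C]-close subsets of them
    meet only finitely many [y m], and finite sets are bounded. *)

Set Implicit Arguments.
Unset Strict Implicit.
Unset Printing Implicit Defensive.

Import Order.TTheory GRing.Theory Num.Theory.
Local Open Scope classical_set_scope.
Local Open Scope ring_scope.

(** * Bounded sets of a ballean *)

Section CoarseStructure.
Context {X : Type} (C : coarse_structure X).

Lemma entourage_of_pair (x y : X) : exists2 E, entourages C E & E (x, y).
Proof.
have [E CE Exy] : (\bigcup_(E in entourages C) E) (x, y).
  by rewrite entourages_cover.
by exists E.
Qed.

Lemma bounded_image (E : set (X * X)) (A B : set X) : entourages C E ->
  B `<=` ent_image E A -> bounded C A -> bounded C B.
Proof.
move=> CE BEA [E1 [z [CE1 AE1]]]; exists (E \; E1)%relation, z; split.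
  exact: entourages_compose.
move=> b /BEA[a /AE1]; rewrite !xsectionE => E1a Eab.
by exists a.
Qed.

Lemma bounded_sub (A B : set X) : B `<=` A -> bounded C A -> bounded C B.
Proof.
by move=> BA [E [x [CE AE]]]; exists E, x; split=> // b /BA /AE.
Qed.

Lemma bounded_initial_segment (y : nat -> X) (M : nat) :
  bounded C [set y m | m in [set m | (m < M)%N]].
Proof.
elim: M => [|M [E [z [CE yE]]]].
  have [E CE _] := entourage_of_pair (y 0%N) (y 0%N).
  by exists E, (y 0%N); split=> // z [m].
have [E1 CE1 E1zy] := entourage_of_pair z (y M).
exists (E1 \; E)%relation, z; split; first exact: entourages_compose.
move=> _ [m /= + <-]; rewrite xsectionE ltnS leq_eqVlt => /orP[/eqP ->|mM].
  by exists z => //; apply: (entourages_diagonal CE).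
exists (y m); last exact: (entourages_diagonal CE1).
by have /= := yE (y m) (ex_intro2 _ _ m mM erefl); rewrite xsectionE.
Qed.

(** Since [set0] has no unbounded subset, the relation [linked] determines the bounded sets. The
    point [x] is needed because on an empty type not even [set0] is bounded. *)
Lemma bounded_linked0 (x : X) (A : set X) : bounded C A <-> linked C A set0.
Proof.
have b0 : bounded C set0.
  by have [E CE _] := entourage_of_pair x x; exists E, x; split.
split=> [bA|[[]//|[A' [B' [_ B'0 _ uB' _]]]]]; first by left.
by exfalso; apply: uB'; apply: bounded_sub b0.
Qed.

End CoarseStructure.

Lemma lambda_equivalent_bounded (X : Type) (C C' : coarse_structure X)
    (A : set X) (x : X) :
  lambda_equivalent C C' -> bounded C' A -> bounded C A.
Proof. by move=> CC' /(bounded_linked0 C' x); rewrite -CC' -bounded_linked0. Qed.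

(** * Bornologous functions and submetrizability *)

Section Bornologous.
Context {R : realType} {X : Type}.
Implicit Types (C : coarse_structure X) (f : X -> R).

Definition bornologous f C := forall E, entourages C E ->
  exists K, forall x y, E (x, y) -> `|f x - f y| <= K.

(* Quantifying over a base point makes this vacuous on the empty type, whose
   balleans are unbounded. *)
Definition unbounded_range f := forall x K, exists y, K < `|f x - f y|.

Lemma unbounded_range_ballean C f :
  bornologous f C -> unbounded_range f -> unbounded_ballean C.
Proof.
move=> bf uf [E [x [/bf[K EK] XE]]]; have [y] := uf x K.
rewrite ltNge => /negP; apply; apply: EK.
by have /= := XE y I; rewrite xsectionE.
Qed.

(** This is the largest coarse structure for which [f] is bornologous. *)
Definition pullback_entourages f : set (set (X * X)) :=
  [set E | diagonal `<=` E /\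
           exists K, forall x y, E (x, y) -> `|f x - f y| <= K].

Lemma pullback_diagonal f E : pullback_entourages f E -> diagonal `<=` E.
Proof. by case. Qed.

Lemma pullback_compose f E E' : pullback_entourages f E ->
  pullback_entourages f E' -> pullback_entourages f (E' \; E)%relation.
Proof.
move=> [dE [K EK]] [dE' [K' EK']]; split.
  by move=> [x y] /= xy; exists x; [exact: dE|exact: dE'].
exists (K + K') => x y [z /= /EK xz /EK' zy].
by rewrite (le_trans (ler_distD (f z) _ _)) // lerD.
Qed.

Lemma pullback_inv f E :
  pullback_entourages f E -> pullback_entourages f (E^-1)%relation.
Proof.
move=> [dE [K EK]]; split; first by move=> [x y] xy; apply: dE; exact/esym.
by exists K => x y /EK; rewrite distrC.
Qed.

Lemma pullback_sub f E E' : pullback_entourages f E ->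
  diagonal `<=` E' -> E' `<=` E -> pullback_entourages f E'.
Proof. by move=> [_ [K EK]] dE' EE'; split=> //; exists K => x y /EE' /EK. Qed.

Lemma pullback_cover f : \bigcup_(E in pullback_entourages f) E = setT.
Proof.
apply/seteqP; split=> // -[x y] _.
exists [set p | `|f p.1 - f p.2| <= `|f x - f y|] => //=; split.
  by move=> [a b] /diagonalP -> /=; rewrite subrr normr0.
by exists `|f x - f y|.
Qed.

Definition pullback_structure f : coarse_structure X :=
  CoarseStructure (@pullback_diagonal f) (@pullback_compose f)
    (@pullback_inv f) (@pullback_sub f) (pullback_cover f).

(* The pseudometric [|f x - f y|] is made definite by adding the discrete
   metric, which does not change the coarse structure. *)
Lemma metrizable_pullback f : metrizable R (pullback_structure f).
Proof.
pose e (x y : X) : R := (`[< x <> y >])%:R.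
have e0 x y : 0 <= e x y by rewrite /e ler0n.
have e1 x y : e x y <= 1 by rewrite /e lern1 leq_b1.
have exx x : e x x = 0 by rewrite /e; case: asboolP.
exists (fun x y => `|f x - f y| + e x y); split.
  split=> [x y|x y|x y|x y z].
  - by rewrite addr_ge0.
  - split=> [|->]; last by rewrite subrr normr0 exx addr0.
    move=> /eqP; rewrite paddr_eq0 // => /andP[_].
    by rewrite /e; case: asboolP => [_|/contrapT//]; rewrite oner_eq0.
  - rewrite distrC /e; congr (_ + (nat_of_bool _)%:R).
    by apply: asbool_equiv_eq; split=> + /esym.
  - rewrite addrACA lerD ?ler_distD //.
    have [<-|xy] := pselect (x = y); first by rewrite exx add0r.
    rewrite (le_trans (e1 _ _)) // -[leLHS]addr0 lerD //.
    by rewrite /e; case: asboolP.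
split=> [_ [r /= r0 <-]|E [dE [K EK]]].
  split; first by move=> [a b] /diagonalP -> /=; rewrite subrr normr0 exx addr0.
  by exists r => x y /=; have := e0 x y; lra.
(* The term [e] adds at most 1, and the absolute value keeps the radius positive for every [K]. *)
exists [set p | `|f p.1 - f p.2| + e p.1 p.2 < `|K| + 2] => /=.
  by exists (`|K| + 2) => //=; have := normr_ge0 K; lra.
by move=> [x y] /EK /=; have := e1 x y; have := ler_norm K; lra.
Qed.

Lemma submetrizableP C : submetrizable R C <->
  exists f, [/\ forall x, 0 <= f x, bornologous f C & unbounded_range f].
Proof.
split=> [[_ [C' [CC' uC' [d [[d0 dxx dC dD] [Bent Bbase]]]]]]|[f [_ bf uf]]].
  have [[x0 _]|X0] := pselect (exists x : X, True); last first.
    by exists (fun=> 0); split=> [//|E _|x]; [exists 0 => x|]; case: X0; exists x.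
  exists (d x0); split=> // [E /CC' /Bbase[_ [r r0 <-]] Er|x K].
    exists r => x y /Er /= xyr; rewrite ler_norml.
    by have := dD x0 x y; have := dD x0 y x; rewrite (dC y x); lra.
  apply: contrapT => xK; apply: uC'.
  (* Passing through [x0] gives [d x y <= d x0 x + (d x0 x + K)], so the ball of radius [r] around
     [x] is the whole space. *)
  pose r := d x0 x + `|K| + d x0 x + 1.
  exists [set p | d p.1 p.2 < r], x; split.
    apply: Bent; exists r => //=; rewrite /r.
    by have := d0 x0 x; have := normr_ge0 K; lra.
  move=> y _; rewrite xsectionE /=.
  have : `|d x0 x - d x0 y| <= K.
    by rewrite leNgt; apply/negP => Ky; apply: xK; exists y.
  rewrite ler_norml /r; have := dD x x0 y; rewrite (dC x x0).
  by have := ler_norm K; lra.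
split; first exact: unbounded_range_ballean bf uf.
exists (pullback_structure f); split=> [E CE||].
- by split; [exact: entourages_diagonal CE|exact: bf].
- by apply: (unbounded_range_ballean (f := f)) => // E [].
- exact: metrizable_pullback.
Qed.

End Bornologous.

(** * Transfer along a lambda-equivalence *)

Section LambdaEquivalent.
Context {R : realType} {X : Type} {C C' : coarse_structure X}.
Hypothesis CC' : lambda_equivalent C C'.
Variable f : X -> R.
Hypotheses (f_ge0 : forall x, 0 <= f x) (bf : bornologous f C).

Lemma lambda_no_separated_pairs (E : set (X * X)) (x y : nat -> X) (c : R) :
  entourages C' E -> (forall n, E (x n, y n)) ->
  (forall n m, m%:R - c <= `|f (x n) - f (y m)|) -> False.
Proof.
move=> C'E Exy sep.
(* Only indices [m <= K + c] can occur, whatever [n] is. *)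
have yfin (K : R) (B : set X) : B `<=` range y ->
    (forall b, B b -> exists n, `|f (x n) - f b| <= K) -> bounded C B.
  move=> By BK.
  apply: bounded_sub (bounded_initial_segment C y (Num.truncn (K + c)).+1).
  move=> b Bb; have [m _ ymb] := By b Bb; have [n] := BK b Bb.
  rewrite -ymb => nmK; exists m => //=.
  have m0 : 0 <= m%:R :> R by [].
  by rewrite ltnS truncn_ge_nat; have := sep n m; lra.
have uyC : unbounded C (range y).
  move=> [E1 [z [CE1 yE1]]]; have [K E1K] := bf CE1.
  have [m mK] : exists m : nat, K + `|f (x 0%N) - f z| + c < m%:R.
    by exists (Num.truncn (K + `|f (x 0%N) - f z| + c)).+1; exact: truncnS_gt.
  have := yE1 (y m) (imageT _ _); rewrite xsectionE => /E1K.
  by have := sep 0%N m; have := ler_distD (f z) (f (x 0%N)) (f (y m)); lra.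
(* As [E] contains the diagonal, [S] contains both [E] and its inverse, so it serves for both
   inclusions of closeness. *)
pose S := (E^-1 \; E)%relation.
have C'S : entourages C' S.
  by apply: entourages_compose => //; exact: entourages_inv.
have yS : range y `<=` ent_image S (range x).
  move=> _ [n _ <-]; exists (x n); first exact: imageT.
  by rewrite xsectionE; exists (y n); [exact: Exy|exact: (entourages_diagonal C'E)].
have xS : range x `<=` ent_image S (range y).
  move=> _ [n _ <-]; exists (y n); first exact: imageT.
  by rewrite xsectionE; exists (y n); [exact: (entourages_diagonal C'E)|exact: Exy].
have uyC' : unbounded C' (range y).
  by move=> /(lambda_equivalent_bounded (x 0%N) CC').
have uxC' : unbounded C' (range x) by move=> /(bounded_image C'S yS).
have : linked C (range x) (range y).
  by rewrite CC'; right; exists (range x), (range y); split=> //; exists S.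
(* Each point of [B] has its [f]-value within some fixed [K] of a value [f (x n)], so [yfin]
   contradicts the unboundedness of [B]. *)
case=> [[_ //]|[A [B [Ax By _ uB [E1 [CE1 _ BE1]]]]]].
have [K E1K] := bf CE1; apply/uB/(yfin K) => // b /BE1[a /Ax[n _ <-]].
by rewrite xsectionE => /E1K; exists n.
Qed.

(** Failure of the one-sided bound gives pairs along which [f] increases arbitrarily much, from
    which separated pairs are selected. The other side comes from the inverse of [E]. *)
Lemma lambda_upper_bound (E : set (X * X)) : entourages C' E ->
  exists K, forall x y, E (x, y) -> f y <= f x + K.
Proof.
move=> C'E; apply: contrapT => nK.
have far (K : R) : exists p, E p /\ f p.1 + K < f p.2.
  apply: contrapT => noK; apply: nK; exists K => x y Exy.
  by rewrite leNgt; apply/negP => ?; apply: noK; exists (x, y).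
(* If the first points can stay at level at most [N] while the second ones escape, these pairs are
   separated with [c = N]. *)
have [[N Nfar]|bnd] := pselect (exists N : R, forall n : nat,
    exists p, [/\ E p, f p.1 <= N & n%:R < f p.2]).
  have [p pP] := choice Nfar.
  apply: (@lambda_no_separated_pairs E (fst \o p) (snd \o p) N) => //= [n|n m].
    by rewrite -surjective_pairing; case: (pP n).
  have [_ xN _] := pP n; have [_ _ my] := pP m.
  by rewrite ler_normr; apply/orP; right; lra.
(* Otherwise pairs with gap above [k] exist beyond every level [N]: if not, a pair with gap above
   [n + k] would start at level at most [N] and, as [f] is nonnegative, end above [n], for every
   [n]. *)
have step (Nk : R * nat) :
    exists p, [/\ E p, Nk.1 < f p.1 & f p.1 + Nk.2%:R < f p.2].
  case: Nk => N k /=; apply: contrapT => noN; apply: bnd.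
  exists N => n; have [p [Ep fp]] := far (n%:R + k%:R).
  have fp0 := f_ge0 p.1; have k0 : 0 <= k%:R :> R by [].
  have n0 : 0 <= n%:R :> R by [].
  exists p; split=> //; last by lra.
  by rewrite leNgt; apply/negP => Np; apply: noN; exists p; split=> //; lra.
have [p pP] := choice step.
(* The state [q n] holds the level to exceed and the gap to achieve. Thus the values at
   [x 0, y 0, x 1, y 1, ...] increase, and both steps ending in the [n]-th pair exceed [n]. *)
pose fix q n : R * nat :=
  if n is n'.+1 then (f (p (q n')).2 + n%:R, n) else (0, 0%N).
pose s n := p (q n).
have q2 n : (q n).2 = n by case: n.
have sE n : E (s n) by have [] := pP (q n).
have sxy n : f (s n).1 + n%:R < f (s n).2.
  by have [_ _] := pP (q n); rewrite q2.
have syx n : f (s n).2 + n.+1%:R < f (s n.+1).1 by have [] := pP (q n.+1).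
have smono : {homo (fun n => f (s n).1) : n m / (n <= m)%N >-> n <= m}.
  apply: homo_leq => [//|a b c|n]; first exact: le_trans.
  have := sxy n; have := syx n; have : 0 <= n%:R :> R by [].
  by have : 0 <= n.+1%:R :> R by []; lra.
apply: (@lambda_no_separated_pairs E (fst \o s) (snd \o s) 0) => //= [n|n m].
  by rewrite -surjective_pairing.
(* For [n <= m] the gap from [x m] to [y m] suffices; for [m < n] it is the one from [y m] to
   [x m.+1]. *)
rewrite ler_normr; apply/orP; have [nm|mn] := leqP n m.
  by right; have := smono _ _ nm; have := sxy m; lra.
by left; have := smono _ _ mn; have := syx m; rewrite -natr1; lra.
Qed.

Lemma lambda_bornologous : bornologous f C'.
Proof.
move=> E C'E; have [K EK] := lambda_upper_bound C'E.
have [K' EK'] := lambda_upper_bound (entourages_inv C'E).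
exists (Num.max K K') => x y Exy; rewrite ler_norml.
have := EK _ _ Exy; have := EK' y x Exy.
have : K <= Num.max K K' by rewrite le_max lexx.
have : K' <= Num.max K K' by rewrite le_max lexx orbT.
by lra.
Qed.

End LambdaEquivalent.

Theorem corollary8 (R : realType) : lambda_stable (@submetrizable R).
Proof.
move=> X C C' CC' /submetrizableP[f [f0 bf uf]].
by apply/submetrizableP; exists f; split=> //; exact: lambda_bornologous CC' _ _ _.
Qed.
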